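(* Let $\varepsilon>0$, $\theta_\varepsilon=\varepsilon/(1+\varepsilon)$, and let $\mathcal{T}=(a,b,c)$ be a parity-class triple with $K=(a+b)/2>1$ and $E_\varepsilon(\mathcal{T})\ge0$. Then at least two distinct primes $p\mid abc$ satisfy $v_p(N_p)\ge2$. More precisely, for every prime $p\mid abc$ one has $$\delta_{\mathrm{tot}}(\mathcal{T})-x_p\ \ge\ \log\left(2-\frac1K\right)+\theta_\varepsilon\log(2K).$$
   Context: A parity-class triple is a triple $\mathcal{T}=(a,b,c)$ of pairwise coprime positive integers with $a+b=c$, $a$ and $b$ odd, $c$ even; $K=(a+b)/2$, so $c=2K$. $\mathrm{rad}(n)$ is the product of the distinct primes dividing $n$, $v_p$ is the $p$-adic valuation, and $E_\varepsilon(\mathcal{T})=\log c-(1+\varepsilon)\log\mathrm{rad}(abc)$. For each prime $p\mid abc$, $N_p$ denotes the unique member of $\{a,b,c\}$ divisible by $p$, and $x_p=(v_p(N_p)-1)\log p$. The total defect is $\delta_{\mathrm{tot}}(\mathcal{T})=\delta_2+\delta^{\mathcal K}+\delta_{\mathrm{lin}}$, where $\delta_2=v_2(K)\log2$, $\delta^{\mathcal K}=\sum_{p\mid K,\,p\text{ odd}}(v_p(K)-1)\log p$ and $\delta_{\mathrm{lin}}=\log\bigl(ab/(\mathrm{rad}(a)\mathrm{rad}(b))\bigr)$; equivalently $\delta_{\mathrm{tot}}(\mathcal{T})=\log\bigl(abc/\mathrm{rad}(abc)\bigr)=\sum_{p\mid abc}x_p$. *)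

(* Defs.v *)
From mathcomp Require Import all_boot all_order all_algebra.
From mathcomp Require Import reals exp.

Set Implicit Arguments.
Unset Strict Implicit.
Unset Printing Implicit Defensive.

Import Order.TTheory GRing.Theory Num.Theory.

Record parity_triple := ParityTriple {
  ta : nat;
  tb : nat;
  tc : nat;
  ta_gt0 : 0 < ta;
  tb_gt0 : 0 < tb;
  tc_gt0 : 0 < tc;
  coprime_ab : coprime ta tb;
  coprime_ac : coprime ta tc;
  coprime_bc : coprime tb tc;
  tabE : ta + tb = tc;
  ta_odd : odd ta;
  tb_odd : odd tb;
  tc_even : ~~ odd tc
}.

Definition abc (T : parity_triple) : nat := ta T * tb T * tc T.

(* The halving is exact since ta and tb are odd: see tc_double. *)
Definition tK (T : parity_triple) : nat := (ta T + tb T)./2.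

Definition rad (n : nat) : nat := \prod_(p <- primes n) p.

(* Only meaningful for a prime p dividing abc; the order in which the members
   are tested is then irrelevant: see memberP and member_unique. *)
Definition member (T : parity_triple) (p : nat) : nat :=
  if p %| ta T then ta T else if p %| tb T then tb T else tc T.

Lemma tc_double (T : parity_triple) : tc T = 2 * tK T.
Proof.
by rewrite /tK tabE mul2n -[LHS]odd_double_half (negbTE (tc_even T)).
Qed.

Lemma memberP (T : parity_triple) (p : nat) : prime p -> p %| abc T ->
  (member T p \in [:: ta T; tb T; tc T]) && (p %| member T p).
Proof.
move=> p_pr; rewrite /abc /member !Euclid_dvdM // !inE.
case: ifP => [->|_]; first by rewrite eqxx.
case: ifP => [->|_]; first by rewrite eqxx /= orbT.
by move=> /= ->; rewrite eqxx !orbT.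
Qed.

Lemma member_unique (T : parity_triple) (p n : nat) : prime p ->
  n \in [:: ta T; tb T; tc T] -> p %| n -> n = member T p.
Proof.
move=> p_pr nT pn.
have excl x y : coprime x y -> p %| x -> p %| y -> false.
  move=> cxy px py; have : p %| gcdn x y by rewrite dvdn_gcd px py.
  by rewrite (eqP cxy) dvdn1 => /eqP p1; rewrite p1 in p_pr.
have [ab ac bc] := And3 (coprime_ab T) (coprime_ac T) (coprime_bc T).
rewrite /member; move: nT; rewrite !inE => /or3P[] /eqP nE; rewrite nE in pn *.
- by rewrite pn.
- by case: ifP => [pa|_]; [have := excl _ _ ab pa pn | rewrite pn].
- case: ifP => [pa|_]; first by have := excl _ _ ac pa pn.
  by case: ifP => [pb|//]; have := excl _ _ bc pb pn.
Qed.

Local Open Scope ring_scope.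

Definition excess (R : realType) (eps : R) (T : parity_triple) : R :=
  ln (tc T)%:R - (1 + eps) * ln (rad (abc T))%:R.

Definition local_defect (R : realType) (T : parity_triple) (p : nat) : R :=
  ((logn p (member T p))%:R - 1) * ln p%:R.

Definition delta2 (R : realType) (T : parity_triple) : R :=
  (logn 2 (tK T))%:R * ln 2%:R.

Definition deltaK (R : realType) (T : parity_triple) : R :=
  \sum_(p <- primes (tK T) | odd p) ((logn p (tK T))%:R - 1) * ln p%:R.

Definition delta_lin (R : realType) (T : parity_triple) : R :=
  ln ((ta T * tb T)%:R / ((rad (ta T))%:R * (rad (tb T))%:R)).

Definition delta_tot (R : realType) (T : parity_triple) : R :=
  delta2 R T + deltaK R T + delta_lin R T.

Definition theta (R : realType) (eps : R) : R := eps / (1 + eps).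

(* Main.v *)
Require Import Defs.
From mathcomp Require Import all_boot all_order all_algebra.
From mathcomp Require Import reals exp.
From mathcomp Require Import zify ring lra.

(** The total defect is [ln (abc) - ln (rad (abc))]: the three pieces defining
    it are the sums of [(v_p - 1) ln p] over the primes of [c = 2K], [a] and
    [b], and this sum is additive over coprime factors ([delta_totE],
    [defectE]).  Nonnegative excess says [ln rad(abc) <= ln c / (1 + eps)], so
    [ln c - ln rad(abc) >= theta ln c].  What is left of
    [delta_tot - x_p] is [ln (ab) - x_p], and the claim reduces to the integer
    inequality [2 (c - 1) p^(v - 1) <= c (a b)] of [power_bound]: if [p | c]
    then [p^(v-1) <= c / 2] while [a + b - 1 <= a b]; if [p] divides [a] or
    [b], then [2 p^(v-1)] is at most that member.

    Since [K > 1], the lower bound is positive.  So for every [p] some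
    prime [q <> p] contributes to the defect ([other_high_prime]).  Starting
    from [p = 2] this yields one prime of multiplicity at least 2, and
    starting from that prime it yields a second one. *)

Import Order.TTheory GRing.Theory Num.Theory.
Local Open Scope ring_scope.

Definition defect (R : realType) (n : nat) : R :=
  \sum_(p <- primes n) ((logn p n)%:R - 1) * ln p%:R.

Lemma ln_prod_nat (R : realType) (I : eqType) (s : seq I) (F : I -> nat) :
  (forall i, i \in s -> 0 < F i)%N ->
  ln (\prod_(i <- s) F i)%:R = \sum_(i <- s) ln (F i)%:R :> R.
Proof.
elim: s => [|i s IH] Fgt0; first by rewrite !big_nil ln1.
have Fs j : j \in s -> (0 < F j)%N.
  by move=> js; apply: Fgt0; rewrite inE js orbT.
rewrite !big_cons natrM lnM ?IH // posrE ltr0n; first by rewrite Fgt0 ?mem_head.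
by rewrite big_seq prodn_cond_gt0.
Qed.

Lemma rad_gt0 n : (0 < Defs.rad n)%N.
Proof.
rewrite /Defs.rad big_seq prodn_cond_gt0 // => p.
by rewrite mem_primes => /andP[/prime_gt0].
Qed.

Lemma defectE (R : realType) n : (0 < n)%N ->
  defect R n = ln n%:R - ln (Defs.rad n)%:R.
Proof.
move=> n0.
have pos p : p \in primes n -> (0 < p)%N.
  by rewrite mem_primes => /andP[/prime_gt0].
rewrite {2}[n]prod_prime_decomp // prime_decompE big_map /= /Defs.rad.
have powpos p : p \in primes n -> (0 < p ^ logn p n)%N.
  by move=> /pos p0; rewrite expn_gt0 p0.
rewrite !ln_prod_nat //.
rewrite -sumrB; apply: eq_big_seq => p /pos p0.
by rewrite natrX lnXn ?ltr0n // mulrBl mul1r mulr_natl.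
Qed.

Lemma logn_coprime_mul p m n : (0 < m)%N -> (0 < n)%N -> coprime m n ->
  p \in primes m -> logn p (m * n) = logn p m.
Proof.
move=> m0 n0 cmn; rewrite mem_primes => /and3P[_ _ pm].
by rewrite lognM // [logn p n]logn_coprime ?addn0 // (coprime_dvdl pm).
Qed.

Lemma perm_primes_mul m n : (0 < m)%N -> (0 < n)%N -> coprime m n ->
  perm_eq (primes (m * n)) (primes m ++ primes n).
Proof.
move=> m0 n0 cmn; apply: uniq_perm; first exact: primes_uniq.
  by rewrite cat_uniq !primes_uniq andbT /= -coprime_has_primes.
by move=> p; rewrite mem_cat primesM.
Qed.

Lemma defectM (R : realType) m n : (0 < m)%N -> (0 < n)%N -> coprime m n ->
  defect R (m * n) = defect R m + defect R n.
Proof.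
move=> m0 n0 cmn; rewrite /defect (perm_big _ (perm_primes_mul m n m0 n0 cmn)).
rewrite big_cat /=; congr (_ + _); apply: eq_big_seq => p pP.
  by rewrite logn_coprime_mul.
by rewrite mulnC logn_coprime_mul // coprime_sym.
Qed.

(** Doubling raises the exponent of 2 by exactly one, which is why the
    contribution of 2 to the defect of [2 * k] is the full [v_2(k) ln 2],
    whether or not 2 divides [k]. *)
Lemma defect_double (R : realType) k : (0 < k)%N ->
  defect R (2 * k) = (logn 2 k)%:R * ln 2%:R +
    \sum_(p <- primes k | odd p) ((logn p k)%:R - 1) * ln p%:R.
Proof.
move=> k0; have perm2 : perm_eq (primes (2 * k)) (2 :: [seq p <- primes k | odd p])%N.
  apply: uniq_perm; first exact: primes_uniq.
    by rewrite /= mem_filter /= filter_uniq ?primes_uniq.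
  move=> p; rewrite primesM // [primes 2]/= !inE mem_filter.
  have [//|p2 /=] := eqVneq p 2%N.
  rewrite mem_primes; case pp: (prime p) => /=; last by rewrite andbF.
  by case: (even_prime pp) => [e|->] //; rewrite e in p2.
rewrite /defect (perm_big _ perm2) big_cons big_filter lognM // logn_prime //=.
rewrite natrD addrAC subrr add0r; congr (_ + _).
rewrite big_seq_cond [RHS]big_seq_cond; apply: eq_bigr => p /andP[_ po].
rewrite lognM // logn_prime //; case: eqVneq => // e.
by rewrite e in po.
Qed.

Lemma abc_gt0 T : (0 < abc T)%N.
Proof. by rewrite /abc !muln_gt0 ta_gt0 tb_gt0 tc_gt0. Qed.

Lemma delta_totE (R : realType) T : delta_tot R T = defect R (abc T).
Proof.
have [a0 b0 c0] := And3 (ta_gt0 T) (tb_gt0 T) (tc_gt0 T).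
have K0 : (0 < tK T)%N by move: c0; rewrite tc_double; lia.
rewrite /abc defectM ?muln_gt0 ?a0 //; last first.
  by rewrite coprimeMl coprime_ac coprime_bc.
rewrite [in RHS]tc_double defect_double // defectM ?coprime_ab //.
rewrite /delta_tot /delta2 /deltaK addrC; congr (_ + _).
rewrite /delta_lin !defectE // ln_div ?posrE ?mulr_gt0 ?ltr0n ?muln_gt0 ?rad_gt0 ?a0 //.
by rewrite natrM !lnM ?posrE ?ltr0n ?rad_gt0 //; ring.
Qed.

Lemma logn_abc T p : prime p -> (p %| abc T)%N ->
  logn p (abc T) = logn p (member T p).
Proof.
move=> pp pd; have [a0 b0 c0] := And3 (ta_gt0 T) (tb_gt0 T) (tc_gt0 T).
have z x y : coprime x y -> (p %| x)%N -> logn p y = 0%N.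
  by move=> cxy px; rewrite logn_coprime // (coprime_dvdl px).
have ba : coprime (tb T) (ta T) by rewrite coprime_sym coprime_ab.
have ca : coprime (tc T) (ta T) by rewrite coprime_sym coprime_ac.
have cb : coprime (tc T) (tb T) by rewrite coprime_sym coprime_bc.
rewrite /abc !lognM ?muln_gt0 ?a0 //.
have /andP[] := memberP pp pd; rewrite !inE.
case/or3P => /eqP -> pN.
- by rewrite (z _ _ (coprime_ab T) pN) (z _ _ (coprime_ac T) pN) !addn0.
- by rewrite (z _ _ ba pN) (z _ _ (coprime_bc T) pN) addn0.
- by rewrite (z _ _ ca pN) (z _ _ cb pN).
Qed.

Lemma expn_pred_logn_le p n : prime p -> (0 < n)%N -> (p %| n)%N ->
  (p ^ (logn p n).-1 * p <= n)%N.
Proof.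
move=> pp n0 pn; rewrite -expnSr prednK ?logn_gt0 ?mem_primes ?pp ?n0 //.
exact/dvdn_leq/pfactor_dvdnn.
Qed.

(** The case split: for [p] dividing [c] the bound [p >= 2] only gives
    [p^(v-1) <= c/2], compensated by [(a - 1) (b - 1) >= 0]; for [p] dividing
    [a] or [b], the power is at most half of that member, with no help from the
    other factor. *)
Lemma power_bound T p : prime p -> (p %| abc T)%N ->
  (2 * (tc T).-1 * p ^ (logn p (member T p)).-1 <= tc T * (ta T * tb T))%N.
Proof.
move=> pp pd; have [a0 b0 c0] := And3 (ta_gt0 T) (tb_gt0 T) (tc_gt0 T).
have p2 := prime_gt1 pp; have cE := tabE T.
have /andP[] := memberP pp pd; rewrite !inE.
case/or3P => /eqP -> pN; have := expn_pred_logn_le _ _ pp _ pN => /(_ ltac:(by [])).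
all: move: (_ ^ _)%N => P PN.
- have h : (P * 2 <= ta T)%N by apply: leq_trans PN; rewrite leq_mul2l p2 orbT.
  have -> : (2 * (tc T).-1 * P = (tc T).-1 * (P * 2))%N by lia.
  by apply: leq_mul; [exact: leq_pred | apply: leq_trans h _; exact: leq_pmulr].
- have h : (P * 2 <= tb T)%N by apply: leq_trans PN; rewrite leq_mul2l p2 orbT.
  have -> : (2 * (tc T).-1 * P = (tc T).-1 * (P * 2))%N by lia.
  by apply: leq_mul; [exact: leq_pred | apply: leq_trans h _; exact: leq_pmull].
- have h : (P * 2 <= tc T)%N by apply: leq_trans PN; rewrite leq_mul2l p2 orbT.
  have -> : (2 * (tc T).-1 * P = (P * 2) * (tc T).-1)%N by lia.
  by apply: leq_mul => //; nia.
Qed.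

Lemma local_defectE (R : realType) T p : prime p -> (p %| abc T)%N ->
  local_defect R T p = ln (p ^ (logn p (member T p)).-1)%:R.
Proof.
move=> pp pd; rewrite natrX lnXn ?ltr0n ?prime_gt0 // /local_defect.
rewrite -logn_abc // -[X in _ = X]mulr_natl; congr (_ * _).
by rewrite -subn1 natrB // logn_gt0 mem_primes pp abc_gt0.
Qed.

Lemma defect_lower_bound (R : realType) (eps : R) T p : 0 < eps ->
  (1 < tK T)%N -> 0 <= excess eps T -> prime p -> (p %| abc T)%N ->
  ln (2 - 1 / (tK T)%:R) + theta eps * ln (2 * (tK T)%:R)
    <= delta_tot R T - local_defect R T p.
Proof.
move=> e0 K1 hE pp pd; have [a0 b0 c0] := And3 (ta_gt0 T) (tb_gt0 T) (tc_gt0 T).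
have cE := tc_double T.
have P0 : (0 < p ^ (logn p (member T p)).-1)%N by rewrite expn_gt0 prime_gt0.
have := power_bound T p pp pd.
rewrite delta_totE defectE ?abc_gt0 // local_defectE //.
have K0 : (0 : R) < (tK T)%:R by rewrite ltr0n; lia.
have -> : 2 * (tK T)%:R = (tc T)%:R :> R by rewrite cE natrM.
have -> : 2 - 1 / (tK T)%:R = (2 * (tc T).-1)%:R / (tc T)%:R :> R.
  rewrite -subn1 cE !natrM natrB ?muln_gt0; last by lia.
  by rewrite natrM; field; rewrite lt0r_neq0.
have -> : ln (abc T)%:R = ln (ta T)%:R + ln (tb T)%:R + ln (tc T)%:R :> R.
  by rewrite /abc !natrM !lnM ?posrE ?mulr_gt0 ?ltr0n.
have c1 : (0 < 2 * (tc T).-1)%N by lia.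
rewrite -(@ler_nat R) -ler_ln ?posrE ?ltr0n ?muln_gt0 ?P0 ?a0 ?b0 ?c0 //; last by lia.
rewrite !natrM !lnM ?lnV ?posrE ?mulr_gt0 ?invr_gt0 ?ltr0n ?a0 ?b0 ?c0 //; try lia.
have : ln (Defs.rad (abc T))%:R <= ln (tc T)%:R - theta eps * ln (tc T)%:R.
  have e1 : 0 < 1 + eps by lra.
  rewrite -(ler_pM2l e1) /theta.
  have -> : (1 + eps) * (ln (tc T)%:R - eps / (1 + eps) * ln (tc T)%:R) =
     ln (tc T)%:R by field; rewrite lt0r_neq0.
  by move: hE; rewrite /excess subr_ge0.
lra.
Qed.

Lemma defect_lower_bound_gt0 (R : realType) (eps : R) K : 0 < eps ->
  (1 < K)%N -> 0 < ln (2 - 1 / K%:R) + theta eps * ln (2 * K%:R).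
Proof.
move=> e0 K1; have k1 : (1 : R) < K%:R by rewrite ltr1n.
have k0 : (0 : R) < K%:R by lra.
apply: addr_gt0.
  by rewrite ln_gt0 // ltrBrDl -ltrBrDr ltr_pdivrMr //; lra.
by rewrite mulr_gt0 ?ln_gt0 ?divr_gt0 //; lra.
Qed.

Lemma other_high_prime (R : realType) T p : prime p -> (p %| abc T)%N ->
  0 < delta_tot R T - local_defect R T p ->
  exists q, [/\ p <> q, prime q, (q %| abc T)%N &
                (2 <= logn q (member T q))%N].
Proof.
move=> pp pd.
have pP : p \in primes (abc T) by rewrite mem_primes pp abc_gt0.
rewrite delta_totE /defect (big_rem p) //= /local_defect -logn_abc //.
rewrite addrAC subrr add0r => spos.
have [/hasP[q qP v2]|/hasPn low] :=
    boolP (has (fun q => 2 <= logn q (abc T))%N (rem p (primes (abc T)))).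
  move: qP; rewrite mem_rem_uniq ?primes_uniq // !inE => /andP[/eqP qp].
  rewrite mem_primes => /and3P[qq _ qd].
  by exists q; split=> //; [exact/nesym | rewrite -logn_abc].
(* All remaining exponents equal 1, so that the remaining sum vanishes. *)
move: spos; rewrite big_seq big1 ?ltxx // => q qP.
have /mem_rem := qP; rewrite -logn_gt0 => v1.
have -> : logn q (abc T) = 1%N by have := low q qP; lia.
by rewrite subrr mul0r.
Qed.

Theorem theorem4p26 (R : realType) (eps : R) (T : parity_triple)
  (heps : 0 < eps) (hK : (1 < tK T)%N) (hE : 0 <= excess eps T) :
  (exists p q : nat,
     [/\ p <> q,
         [/\ prime p, (p %| abc T)%N & (2 <= logn p (member T p))%N]
       & [/\ prime q, (q %| abc T)%N & (2 <= logn q (member T q))%N]])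
  /\
  (forall p : nat, prime p -> (p %| abc T)%N ->
     ln (2 - 1 / (tK T)%:R) + theta eps * ln (2 * (tK T)%:R)
       <= delta_tot R T - local_defect R T p).
Proof.
have bound p := @defect_lower_bound R eps T p heps hK hE.
split; last exact: bound.
have other p : prime p -> (p %| abc T)%N -> exists q, [/\ p <> q, prime q,
    (q %| abc T)%N & (2 <= logn q (member T q))%N].
  move=> pp pd; apply: (other_high_prime R) => //.
  exact: lt_le_trans (defect_lower_bound_gt0 R eps _ heps hK) (bound p pp pd).
have d2 : (2 %| abc T)%N by rewrite /abc tc_double dvdn_mull ?dvdn_mulr.
have [p [_ pp pd p2]] := other 2%N isT d2.
have [q [pq qq qd q2]] := other p pp pd.
by exists p, q.
Qed.
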